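(* Let $d\geq 1$ be an integer and let $(V,E)$ be a finite undirected $d$-regular multi-graph with $|V|\geq 4$. Suppose there are permutations $\theta_1,\dots,\theta_d: V\to V$ such that, for every $v\in V$, the vertices $v$ and $\theta_i(v)$ are adjacent for every $1\leq i\leq d$, and $\mathcal{N}(v)=\bigcup_{i=1}^d\{\theta_i(v)\}$. Suppose $V$ carries a left action of a group $\mathcal{G}$, let $k\geq 1$ be an odd integer, and suppose that the following conditions hold. (1) No index two subgroup of $\mathcal{G}$ acts transitively on $V$. (2) There is a positive integer $t$ such that for each $(u,v)\in V\times V$, the equation $gu=v$ has exactly $t$ distinct solutions $g\in\mathcal{G}$ (in other words, the action is transitive and the stabilizer of each element of $V$ has size $t$). (3) The graph $(V,E)^k$ is an $\varepsilon_k$-vertex expander with $\varepsilon_k>0$. (4) For all $1\leq i_1,\dots,i_k\leq d$ and $v\in V$, there is an automorphism or an anti-automorphism $\psi_{(i_1,\dots,i_k),v}$ of the group $\mathcal{G}$ such that one of $$(\theta_{i_1}\circ\cdots\circ\theta_{i_k})(g\cdot v)=\psi_{(i_1,\dots,i_k),v}(g)\cdot(\theta_{i_1}\circ\cdots\circ\theta_{i_k})(v)$$ and $$(\theta_{i_1}\circ\cdots\circ\theta_{i_k})(g\cdot v)=\psi_{(i_1,\dots,i_k),v}(g^{-1})\cdot(\theta_{i_1}\circ\cdots\circ\theta_{i_k})(v)$$ holds for any $g\in\mathcal{G}$. (5) For any $\tau\in\mathcal{G}$ and any subset $A$ of $V$, $\mathcal{N}^k(\mathcal{N}^k(\tau(A)))\subseteq\tau(\mathcal{N}^k(\mathcal{N}^k(A)))$.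 Then the nontrivial eigenvalues of the normalised adjacency operator of $(V,E)$ are greater than $$\left(-1+\frac{1}{2^{12}d^{8k}}\,\varepsilon_k^4\right)^{1/k},$$ where $x^{1/k}$ denotes the real $k$-th root of the real number $x$. Moreover, if $(V,E)$ is an $\varepsilon$-vertex expander with $\varepsilon>0$, then the vertex Cheeger constant of $(V,E)^k$ is $$\geq\frac12\left(1-\left(1-\frac{\varepsilon^2}{2d^2}\right)^k\right).$$
   Context: Multi-graphs may contain multiple edges and multiple loops; each loop at a vertex increases its degree by one. A multi-graph is $d$-regular if every vertex has degree $d$. The adjacency operator counts edges with multiplicity, and the normalised adjacency operator of a $d$-regular multi-graph is $\frac1d$ times its adjacency operator. The nontrivial eigenvalues of the normalised adjacency operator are its eigenvalues other than $1$ and $-1$. For a subset $V'$ of $V$, $\mathcal{N}(V')$ is the set of vertices adjacent in $(V,E)$ to some element of $V'$, $\mathcal{N}(v)=\mathcal{N}(\{v\})$, and $\mathcal{N}^k$ denotes the $k$-fold iterate of $V'\mapsto\mathcal{N}(V')$ (equivalently, $\mathcal{N}^k(V')$ is the neighbourhood of $V'$ in $(V,E)^k$). For $\tau\in\mathcal{G}$, $\tau(A)=\{\tau\cdot a: a\in A\}$. $(V,E)^k$ denotes the multi-graph with vertex set $V$ whose adjacency operator is the $k$-th power of the adjacency operator of $(V,E)$; it is $d^k$-regular. For a multi-graph on vertex set $V$ and $V_1\subseteq V$, let $N(V_1)$ be the set of vertices adjacent in it to some element of $V_1$ and $\partial(V_1)=N(V_1)\setminus V_1$. The vertex Cheeger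 constant is $h=\inf\{|\partial(V_1)|/|V_1| : \emptyset\neq V_1\subseteq V,\ |V_1|\leq |V|/2\}$. The multi-graph is an $\varepsilon$-vertex expander if $h\geq\varepsilon$. An anti-automorphism of a group $\mathcal{G}$ is a bijection $\psi:\mathcal{G}\to\mathcal{G}$ with $\psi(ab)=\psi(b)\psi(a)$ for all $a,b\in\mathcal{G}$. *)

(* Defs.v *)
From HB Require Import structures.
From mathcomp Require Import all_boot all_order all_algebra all_fingroup.
From mathcomp Require Import all_classical all_reals all_analysis.

Set Implicit Arguments.
Unset Strict Implicit.
Unset Printing Implicit Defensive.

Import Order.TTheory GRing.Theory Num.Theory.
Local Open Scope ring_scope.

(* [mult u v] is the number of edges joining u and v; [mult v v] is the number
   of loops at v, each of which counts once in the degree of v. *)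
Record multigraph (V : finType) := Multigraph {
  mult :> V -> V -> nat;
  mult_sym : forall u v, mult u v = mult v u
}.

Section Multigraph.
Variables (V : finType) (E : multigraph V).

Definition mgregular (d : nat) : Prop := forall v, (\sum_(u : V) E v u)%N = d.

Definition mgadj (u v : V) : bool := (0 < E u v)%N.

Definition nbhd (A : {set V}) : {set V} :=
  [set v | [exists u in A, mgadj u v]]%SET.

Definition adjmx (S : pzSemiRingType) : 'M[S]_#|V| :=
  \matrix_(i, j) (E (enum_val i) (enum_val j))%:R.

Definition normalised_adjmx (R : realType) (d : nat) : 'M[R]_#|V| :=
  d%:R^-1 *: adjmx R.

Lemma tr_adjmxX (k : nat) : (adjmx nat ^+ k)^T = adjmx nat ^+ k.
Proof.
have trA : (adjmx nat)^T = adjmx nat.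
  by apply/matrixP => i j; rewrite !mxE mult_sym.
elim: k => [|k IH]; first by rewrite expr0 trmx1.
by rewrite [in LHS]exprSr exprS -[X in X^T]/(_ *m _) trmx_mul IH trA.
Qed.

Definition pow_mult (k : nat) (u v : V) : nat :=
  (adjmx nat ^+ k) (enum_rank u) (enum_rank v).

Lemma pow_mult_sym k u v : pow_mult k u v = pow_mult k v u.
Proof. by rewrite /pow_mult -[in LHS]tr_adjmxX mxE. Qed.

Definition mgpow (k : nat) : multigraph V := Multigraph (pow_mult_sym k).

Definition boundary (A : {set V}) : {set V} := (nbhd A :\: A)%SET.

Definition cheeger (R : realType) : R :=
  inf [set #|boundary A|%:R / #|A|%:R
        | A in [set A : {set V} | A <> finset.set0 /\ (#|A|.*2 <= #|V|)%N]]%classic.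

Definition vertex_expander (R : realType) (eps : R) : Prop := eps <= cheeger R.

End Multigraph.

Lemma adjmx_mgpow (V : finType) (E : multigraph V) (S : pzSemiRingType) k :
  adjmx (mgpow E k) S = adjmx E S ^+ k.
Proof.
have -> : adjmx (mgpow E k) S = map_mx (GRing.natmul 1) (adjmx E nat ^+ k).
  by apply/matrixP => i j; rewrite !mxE /mgpow /= /pow_mult !enum_valK.
elim: k => [|k IH].
  by apply/matrixP => i j; rewrite !expr0 !mxE; case: (i == j).
rewrite !exprS -IH; apply/matrixP => i j; rewrite !mxE natr_sum.
by apply: eq_bigr => l _; rewrite !mxE natrM natn.
Qed.

Section Group.
Local Open Scope group_scope.
Variable G : groupType.

Definition group_automorphism (psi : G -> G) : Prop :=
  bijective psi /\ {morph psi : a b / a * b}.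

Definition group_anti_automorphism (psi : G -> G) : Prop :=
  bijective psi /\ forall a b, psi (a * b) = psi b * psi a.

Definition left_cosets (H : {pred G}) : set (set G) :=
  [set [set x * h | h in [set` H]] | x in [set: G]]%classic.

Definition index_two_subgroup (H : {pred G}) : Prop :=
  group_closed H /\ (left_cosets H #= `I_2)%card.

Variables (V : finType) (act : G -> V -> V).

(* The library's [action] is a right action of a finite group. *)
Definition left_action : Prop :=
  (forall v, act 1 v = v) /\
  (forall a b v, act (a * b) v = act a (act b v)).

Definition acts_transitively (H : {pred G}) : Prop :=
  forall u v, exists2 h, h \in H & act h u = v.

End Group.

(* theta (i_1) \o ... \o theta (i_k) for the sequence i = [:: i_1; ...; i_k];
   the product of permutations composes in the opposite order. *)
Definition theta_comp (V : finType) (d : nat) (theta : 'I_d -> {perm V})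
  (i : seq 'I_d) (v : V) : V := foldr (fun j w => theta j w) v i.

(* The real k-th root of x, for odd k; x may be negative, whereas the real
   power [_ `^ _] is only meaningful on nonnegative reals. *)
Definition oddroot (R : realType) (k : nat) (x : R) : R :=
  Num.sg x * `|x| `^ (k%:R^-1).

Lemma oddrootK (R : realType) (k : nat) (x : R) :
  odd k -> oddroot k x ^+ k = x.
Proof.
move=> k_odd; have k0 : (0 < k)%N by case: k k_odd.
rewrite /oddroot exprMn -(powR_mulrn k (powR_ge0 _ _)) -powRrM.
rewrite mulVf ?pnatr_eq0 -?lt0n //.
rewrite powRr1 // [RHS]numEsg; have [->|x0] := eqVneq x 0.
  by rewrite normr0 !mulr0.
by rewrite sgr_odd // k_odd expr1.
Qed.

(* Main.v *)
Require Import Defs.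
From HB Require Import structures.
From mathcomp Require Import all_boot all_order all_algebra all_fingroup.
From mathcomp Require Import all_classical all_reals all_analysis.
(* So that set0, subsetP, inE and the like refer to finite sets again. *)
From mathcomp Require Import fintype finset.
From mathcomp Require Import zify ring lra.

Set Implicit Arguments.
Unset Strict Implicit.
Unset Printing Implicit Defensive.

Import Order.TTheory GRing.Theory Num.Theory.
Local Open Scope ring_scope.

(** Write D for d ^ k, M for the k-th power of the graph, N for its neighbourhood
    map, and let f be an eigenfunction of E for a nontrivial lambda, so that f
    is an eigenfunction of the normalised M for m = lambda ^ k.

    Everything spectral rests on the hard half of the Cheeger inequality, in
    the form of a Rayleigh quotient bound on the functions of sum zero
    (rayleigh_gap). For the lower bound on the Cheeger constant of M, that bound
    for E is raised to the odd power k (odd_power_rayleigh) and applied to the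
    indicator of a set minus its mean (cheeger_of_rayleigh).

    For the eigenvalue bound, suppose that m is very close to -1. Then m ^ 2 is
    close to 1 and the same inequality for the square of M yields a set A, of
    size at most half, that N \o N hardly enlarges (almost_bipartite_set). As
    M expands, A has nearly half of the vertices, is almost disjoint from
    N A, and every translate g A either almost equals A or almost misses it
    (almost_half, almost_disjoint_nbhd, translate_dichotomy). The g of
    the first kind form a subgroup H of index at most two
    (almost_stabiliser_index_le2). Averaging over a group all of whose elements
    almost preserve A shows that A almost contains one of its orbits
    (averaging_suborbit); as A is not almost everything, H has index two, so
    it is intransitive and has two orbits of size |V| / 2, one of
    which, O, is almost contained in A.

    Each composite th of k of the permutations maps O = H x to an orbit of
    a twisted copy psi H of H. Two subgroups of index at most two have an
    intersection of index at most four, so O and th O are disjoint or share at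
    least |V| / 4 points (card_twisted_image_suborbit). The latter is impossible
    because th A, inside N A, almost misses A. So O and its complement
    make M bipartite. Changing the sign of f on O now turns the eigenvalue m
    into -m, close to 1, for a function that is still of sum zero, because
    lambda is nontrivial; this contradicts the spectral gap of M
    (bipartite_spectrum). *)

(** * The Cheeger inequality for weighted graphs *)

Section Cheeger.
Variables (R : realFieldType) (V : finType).

(** The co-area argument without level sets: subtracting from p its least
    positive value on its support A lowers the right-hand side by that value times
    the weight of the cut of A, and shrinks the support. *)
Lemma coarea (w : V -> V -> R) (h : R) (p : V -> R) :
  (forall A : {set V}, A != set0 -> (#|A|.*2 <= #|V|)%N ->
     h * #|A|%:R <= \sum_(u in A) \sum_(v in ~: A) w u v) ->
  (forall v, 0 <= p v) -> (#|[set v | (0 < p v)%R]%SET|.*2 <= #|V|)%N ->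
  h * (\sum_v p v) <= \sum_u \sum_v w u v * Num.max 0 (p u - p v).
Proof.
move=> hA; have [m] := ubnP #|[set v | (0 < p v)%R]%SET|.
elim: m p => // m IH p le_m p0 le_n.
set A := [set v | (0 < p v)%R]%SET in le_m le_n *.
have pA v : v \notin A -> p v = 0.
  by rewrite inE -leNgt => pv; apply/eqP; rewrite eq_le pv p0.
have [A0|[a aA]] := set_0Vmem A.
  have p_0 v : p v = 0 by rewrite pA // A0 inE.
  rewrite big1 // mulr0 big1 // => u _; rewrite big1 // => v _.
  by rewrite !p_0 subrr maxxx mulr0.
have [x xA minx] : exists2 x, x \in A & forall y, y \in A -> p x <= p y.
  by have [x] := arg_minP p aA; exists x.
have px : 0 < p x by move: xA; rewrite inE.
pose q v := p v - p x *+ (v \in A).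
have q0 v : 0 <= q v.
  by rewrite /q; case: (boolP (v \in A)) => [/minx|/pA->]; rewrite ?subr_ge0 ?subrr.
have sub : ([set v | (0 < q v)%R] \subset A :\ x)%SET.
  apply/subsetP => v; rewrite !inE /q => qv.
  have vA : v \in A by apply: contraTT qv => vA; rewrite (negbTE vA) pA // subrr ltxx.
  rewrite vA mulr1n in qv; rewrite inE in vA; rewrite vA andbT.
  by apply: contraTneq qv => ->; rewrite subrr ltxx.
have cA : (#|A :\ x| < #|A|)%N by rewrite [ltnRHS](cardsD1 x) xA.
have cq := subset_leq_card sub.
have /= IHq := IH q (leq_trans (leq_ltn_trans cq cA) le_m) q0
  (leq_trans _ le_n).
have {}IHq := IHq ltac:(by rewrite leq_double (leq_trans cq (ltnW cA))).
have A0 : A != set0 by apply/set0Pn; exists a.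
have := hA A A0 le_n => {}hA.
have -> : \sum_v p v = \sum_v q v + p x * #|A|%:R.
  rewrite /q sumrB -[LHS](subrK (\sum_v p x *+ (v \in A))); congr (_ + _).
  under eq_bigr do rewrite -mulr_natr.
  rewrite -mulr_sumr; congr (_ * _).
  rewrite -natr_sum -sum1_card [in RHS]big_mkcond /=; congr (_%:R).
have -> : \sum_u \sum_v w u v * Num.max 0 (p u - p v) =
  \sum_u \sum_v w u v * Num.max 0 (q u - q v) +
  p x * \sum_(u in A) \sum_(v in ~: A) w u v.
  rewrite mulr_sumr [\sum_(u in A) _]big_mkcond -big_split /=.
  apply: eq_bigr => u _; case: (boolP (u \in A)) => uA; last first.
    rewrite addr0; apply: eq_bigr => v _; congr (_ * _).
    by rewrite !max_l // /q ?(negbTE uA) pA // ?subr0 ?sub0r ?oppr_le0 //; apply: q0.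
  rewrite mulr_sumr [\sum_(v in ~: A) _]big_mkcond -big_split /=.
  apply: eq_bigr => v _; rewrite inE /q uA.
  case: (boolP (v \in A)) => vA /=.
    by rewrite addr0; congr (_ * Num.max _ _); ring.
  rewrite (pA _ vA) ?mulr1n ?mulr0n ?subr0 !max_r ?p0 ?subr_ge0 ?minx //.
  ring.
rewrite mulrDr lerD // mulrCA ler_wpM2l // ltW.
Qed.

Lemma median (f : V -> R) : (0 < #|V|)%N -> exists c,
  (#|[set v | (c < f v)%R]%SET|.*2 <= #|V|)%N /\
  (#|[set v | (f v < c)%R]%SET|.*2 <= #|V|)%N.
Proof.
case/card_gt0P => a _.
have [m _ minm] := arg_minP f (erefl : predT a).
pose Q := [pred v | #|[set u | (f u < f v)%R]%SET|.*2 <= #|V|]%N.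
have Qm : Q m.
  rewrite /=; have -> : [set u | (f u < f m)%R]%SET = set0; last by rewrite cards0.
  by apply/setP => u; rewrite !inE ltNge minm.
have [x Qx maxx] := arg_maxP f Qm.
exists (f x); split=> //.
have [->|[b]] := set_0Vmem [set v | (f x < f v)%R]%SET; first by rewrite cards0.
rewrite inE => fb.
have [y fy miny] := arg_minP f (fb : [pred v | f x < f v] b).
have nQy : ~~ Q y by apply: contraL fy => /maxx; rewrite /= -leNgt.
have sub : ([set u | (f u < f y)%R] \subset ~: [set v | (f x < f v)%R])%SET.
  by apply/subsetP => u; rewrite !inE ltNge; apply: contra => /miny.
have := subset_leq_card sub.
move: nQy; rewrite /= -ltnNge.
have := cardsC [set v | (f x < f v)%R]%SET.
rewrite -!addnn; move: #|V| #|[set u | (f u < f y)%R]%SET|.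
by move: #|[set v | (f x < f v)%R]%SET| #|~: [set v | (f x < f v)%R]%SET|; lia.
Qed.

(** The co-area bound for g ^ 2, whose increments factor as
    (g u - g v) (g u + g v); a weighted arithmetic-geometric mean inequality
    replaces the usual Cauchy-Schwarz step and avoids square roots. *)
Lemma cheeger_half_support (w : V -> V -> R) (d h : R) (g : V -> R) :
  (forall u v, 0 <= w u v) -> (forall u v, w u v = w v u) ->
  (forall u, \sum_v w u v = d) -> 0 < h -> 0 < d ->
  (forall A : {set V}, A != set0 -> (#|A|.*2 <= #|V|)%N ->
     h * #|A|%:R <= \sum_(u in A) \sum_(v in ~: A) w u v) ->
  (forall v, 0 <= g v) -> (#|[set v | (0 < g v)%R]%SET|.*2 <= #|V|)%N ->
  h ^+ 2 / d * (\sum_v g v ^+ 2) <= \sum_u \sum_v w u v * (g u - g v) ^+ 2.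
Proof.
move=> w0 wC wd h0 d0 hA g0 gn.
set S := \sum_v g v ^+ 2; set En := \sum_u _.
have gg v : (0 < g v ^+ 2) = (0 < g v).
  by rewrite !lt_def sqr_ge0 g0 !andbT expf_eq0.
have := @coarea w h (fun v => g v ^+ 2) hA (fun v => sqr_ge0 _).
have -> : [set v | (0 < g v ^+ 2)%R]%SET = [set v | (0 < g v)%R]%SET.
  by apply/setP => v; rewrite !inE gg.
move=> /(_ gn); rewrite -/S; set Co := \sum_u _ => hCo.
have CoE : Co *+ 2 = \sum_u \sum_v w u v * `|g u ^+ 2 - g v ^+ 2|.
  rewrite mulr2n {2}/Co exchange_big -big_split; apply: eq_bigr => u _ /=.
  rewrite -big_split /=; apply: eq_bigr => v _; rewrite (wC v u) -mulrDr.
  congr (_ * _); set a := _ ^+ 2; set b := _ ^+ 2.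
  case: (lerP a b) => ab.
    by rewrite max_l ?subr_le0 // max_r ?subr_ge0 // add0r.
  rewrite [Num.max 0 (a - b)]max_r ?subr_ge0 ?(ltW ab) //.
  by rewrite max_l ?subr_le0 ?(ltW ab) // addr0.
(* The weights d / h and h / (2 d) are the ones that give the best final bound. *)
pose F u v := d / h * (w u v * (g u - g v) ^+ 2) + h / (2 * d) * (w u v * g u ^+ 2)
  + h / (2 * d) * (w u v * g v ^+ 2).
have leF u v : w u v * `|g u ^+ 2 - g v ^+ 2| <= F u v.
  rewrite /F [leRHS](_ : _ = w u v * (d / h * (g u - g v) ^+ 2 +
     h / (2 * d) * (g u ^+ 2 + g v ^+ 2))); last by ring.
  rewrite ler_wpM2l // subr_sqr normrM (ger0_norm (addr_ge0 (g0 u) (g0 v))).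
  rewrite -(real_normK (num_real (g u - g v))).
  set x := `|_|; set y := g u + g v.
  have y2 : y ^+ 2 <= 2 * (g u ^+ 2 + g v ^+ 2).
    rewrite -subr_ge0 (_ : _ - _ = (g u - g v) ^+ 2) ?sqr_ge0 // /y; ring.
  have : 0 <= d / h * (x - h / (2 * d) * y) ^+ 2.
    by rewrite mulr_ge0 ?sqr_ge0 // divr_ge0 // ltW.
  rewrite (_ : d / h * _ = d / h * x ^+ 2 - x * y + h / (4 * d) * y ^+ 2); last first.
    by field; rewrite ?gt_eqF.
  have : h / (4 * d) * y ^+ 2 <= h / (4 * d) * (2 * (g u ^+ 2 + g v ^+ 2)).
    by rewrite ler_wpM2l // divr_ge0 ?mulr_ge0 // ltW.
  rewrite [leRHS](_ : _ = h / (2 * d) * (g u ^+ 2 + g v ^+ 2)); last first.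
    by field; rewrite gt_eqF.
  lra.
have : Co *+ 2 <= d / h * En + h * S.
  rewrite CoE; apply: (@le_trans _ _ (\sum_u \sum_v F u v)).
    by apply: ler_sum => u _; apply: ler_sum => v _.
  have S1 : \sum_u \sum_v (w u v * g u ^+ 2) = d * S.
    rewrite mulr_sumr; apply: eq_bigr => u _; rewrite -mulr_suml wd //.
  have S2 : \sum_u \sum_v (w u v * g v ^+ 2) = d * S.
    rewrite exchange_big mulr_sumr; apply: eq_bigr => u _ /=.
    by under eq_bigr do rewrite wC; rewrite -mulr_suml wd.
  under eq_bigr do rewrite !big_split /= -!mulr_sumr.
  rewrite !big_split /= -!mulr_sumr S1 S2 -/En -addrA lerD2l.
  rewrite le_eqVlt; apply/orP; left; apply/eqP; field; rewrite gt_eqF //.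
rewrite mulr2n => ub.
have : h * S <= d / h * En by lra.
rewrite -(ler_pM2l (divr_gt0 h0 d0)) (_ : h / d * (d / h * En) = En); last first.
  by field; rewrite !gt_eqF.
by move=> le; rewrite (_ : _ * S = h / d * (h * S)) //; ring.
Qed.

(** Subtracting a median c makes the positive and the negative part of f - c
    both supported on at most half of the vertices; the energies of the two parts add
    up to at most that of f, and sum zero means that shifting f can only increase
    its norm. *)
Lemma cheeger_rayleigh (w : V -> V -> R) (d h : R) (f : V -> R) :
  (forall u v, 0 <= w u v) -> (forall u v, w u v = w v u) ->
  (forall u, \sum_v w u v = d) -> 0 < h -> 0 < d ->
  (forall A : {set V}, A != set0 -> (#|A|.*2 <= #|V|)%N ->
     h * #|A|%:R <= \sum_(u in A) \sum_(v in ~: A) w u v) ->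
  \sum_v f v = 0 ->
  h ^+ 2 / d * (\sum_v f v ^+ 2) <= \sum_u \sum_v w u v * (f u - f v) ^+ 2.
Proof.
move=> w0 wC wd h0 d0 hA f0.
have [V0|Vn] := posnP #|V|.
  rewrite !big1 ?mulr0 // => u _; by have := fintype0 u V0.
have [c [c1 c2]] := median f Vn.
pose gp v := Num.max 0 (f v - c); pose gn v := Num.max 0 (c - f v).
have gp0 v : 0 <= gp v by rewrite le_max lexx.
have gn0 v : 0 <= gn v by rewrite le_max lexx.
have gpE v : (0 < gp v) = (c < f v) by rewrite lt_max ltxx subr_gt0.
have gnE v : (0 < gn v) = (f v < c) by rewrite lt_max ltxx subr_gt0.
have Hp := cheeger_half_support w0 wC wd h0 d0 hA gp0.
have Hn := cheeger_half_support w0 wC wd h0 d0 hA gn0.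
have {}Hp := Hp ltac:(by under eq_finset do rewrite gpE).
have {}Hn := Hn ltac:(by under eq_finset do rewrite gnE).
apply: (le_trans _ (le_trans (lerD Hp Hn) _)).
  rewrite -mulrDr ler_wpM2l ?divr_ge0 ?sqr_ge0 ?(ltW d0) // -big_split /=.
  have -> : \sum_v f v ^+ 2 = \sum_v (f v ^+ 2 - (2 * c) * f v).
    by rewrite sumrB -mulr_sumr f0 mulr0 subr0.
  apply: ler_sum => v _; rewrite /gp /gn.
  have := sqr_ge0 c.
  case: (lerP (f v) c) => fc; [rewrite max_l ?subr_le0 // max_r ?subr_ge0 //|
    rewrite max_r ?subr_ge0 ?(ltW fc) // max_l ?subr_le0 ?(ltW fc) //]; nra.
rewrite -big_split /=; apply: ler_sum => u _; rewrite -big_split /=.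
apply: ler_sum => v _; rewrite -mulrDr ler_wpM2l //.
have E x : f x = c + gp x - gn x.
  rewrite /gp /gn; case: (lerP (f x) c) => fc; [rewrite max_l ?subr_le0 // max_r ?subr_ge0 //|
    rewrite max_r ?subr_ge0 ?(ltW fc) // max_l ?subr_le0 ?(ltW fc) //]; ring.
have Z x : gp x * gn x = 0.
  rewrite /gp /gn; case: (lerP (f x) c) => fc; [rewrite max_l ?subr_le0 // mul0r //|
    by rewrite mulrC max_l ?mul0r // subr_le0 ?(ltW fc)].
rewrite !E -subr_ge0 (_ : _ - _ = 2 * (gp u * gn v + gp v * gn u) -
   2 * (gp u * gn u + gp v * gn v)); last by ring.
by rewrite !Z addr0 mulr0 subr0 mulr_ge0 // addr_ge0 // mulr_ge0.
Qed.

End Cheeger.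

(** * Neighbourhoods, powers and edge boundaries of multigraphs *)

Section MultigraphFacts.
Variables (V : finType) (E : multigraph V).
Implicit Types A B : {set V}.

Lemma in_nbhd A v : reflect (exists2 u, u \in A & mgadj E u v) (v \in nbhd E A).
Proof. by rewrite inE; exact: exists_inP. Qed.

Lemma mgadj_sym u v : mgadj E u v = mgadj E v u.
Proof. by rewrite /mgadj mult_sym. Qed.

Lemma nbhdS A B : A \subset B -> nbhd E A \subset nbhd E B.
Proof.
move=> /subsetP AB; apply/subsetP => v /in_nbhd[u uA uv].
by apply/in_nbhd; exists u; rewrite ?AB.
Qed.

Lemma nbhdU A B : nbhd E (A :|: B) = nbhd E A :|: nbhd E B.
Proof.
apply/eqP; rewrite eqEsubset subUset !nbhdS ?subsetUl ?subsetUr // !andbT.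
apply/subsetP => v /in_nbhd[u]; rewrite !inE => /orP[] uA uv; apply/orP;
  by [left; apply/exists_inP; exists u|right; apply/exists_inP; exists u].
Qed.

Lemma mgpow0 u v : mgpow E 0 u v = (u == v).
Proof.
rewrite /mgpow /= /pow_mult expr0 mxE; case: eqP => [/enum_rank_inj->|ne].
  by rewrite eqxx.
by case: eqP ne => // ->.
Qed.

Lemma mgpowS k u v :
  mgpow E k.+1 u v = (\sum_x E u x * mgpow E k x v)%N.
Proof.
rewrite /mgpow /= /pow_mult exprS mxE (reindex enum_rank) /=; last first.
  exact/onW_bij/enum_rank_bij.
by apply: eq_bigr => x _; rewrite mxE !enum_rankK natn.
Qed.

Lemma mgpow_regular d k : mgregular E d -> mgregular (mgpow E k) (d ^ k).
Proof.
move=> Ed; elim: k => [|k IH] v.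
  under eq_bigr do rewrite mgpow0.
  rewrite (bigD1 v) //= eqxx big1 ?addn0 // => u /negbTE.
  by rewrite eq_sym => ->.
under eq_bigr do rewrite mgpowS.
rewrite exchange_big /= expnS -[X in (X * _)%N](Ed v) big_distrl /=.
by apply: eq_bigr => x _; rewrite -big_distrr /= IH.
Qed.

End MultigraphFacts.

Section MultigraphPowers.
Variables (V : finType) (E : multigraph V).
Implicit Types A B : {set V}.

Lemma nbhd_mgpow k A : nbhd (mgpow E k) A = iter k (nbhd E) A.
Proof.
elim: k A => [|k IH] A.
  apply/setP => v; rewrite inE; apply/exists_inP/idP => [[u uA]|vA].
    by rewrite /mgadj mgpow0; case: eqP => // <-.
  by exists v => //; rewrite /mgadj mgpow0 eqxx.
rewrite iterSr -IH; apply/setP => v; rewrite [LHS]inE.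
apply/exists_inP/in_nbhd => [[u uA]|[x /in_nbhd[u uA ux] xv]].
  rewrite /mgadj mgpowS lt0n sum_nat_eq0 negb_forall => /existsP[x].
  rewrite implyTb muln_eq0 negb_or -!lt0n => /andP[ux xv].
  by exists x => //; apply/in_nbhd; exists u.
exists u => //; rewrite /mgadj mgpowS lt0n sum_nat_eq0 negb_forall.
by apply/existsP; exists x; rewrite implyTb muln_eq0 negb_or -!lt0n; apply/andP.
Qed.

End MultigraphPowers.

Section Boundary.
Variables (V : finType) (E : multigraph V).
Implicit Types A B : {set V}.

Lemma card_nbhd_le d A : mgregular E d -> (#|nbhd E A| <= d * #|A|)%N.
Proof.
move=> Ed; rewrite mulnC -sum_nat_const -sum1_card.
apply: (@leq_trans (\sum_(v in nbhd E A) \sum_(u in A) E u v)%N).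
  apply: leq_sum => v /in_nbhd[u uA uv].
  by rewrite (bigD1 u) //= (leq_trans uv) // leq_addr.
rewrite exchange_big /=; apply: leq_sum => u uA.
by rewrite -(Ed u) [leqRHS](bigID (mem (nbhd E A))) /= leq_addr.
Qed.

Lemma boundary_le_cut A :
  (#|boundary E A| <= \sum_(u in A) \sum_(v in ~: A) E u v)%N.
Proof.
rewrite exchange_big /= -sum1_card [leqRHS](bigID (mem (nbhd E A))) /=.
apply: leq_trans (leq_addr _ _).
rewrite [leqRHS](eq_bigl (mem (boundary E A))); last by move=> v; rewrite !inE.
apply: leq_sum => v; rewrite inE => /andP[vA /in_nbhd[u uA uv]].
by rewrite (bigD1 u) //= (leq_trans uv) // leq_addr.
Qed.

Lemma cut_le_boundary d A : mgregular E d ->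
  (\sum_(u in A) \sum_(v in ~: A) E u v <= d * #|boundary E A|)%N.
Proof.
move=> Ed; rewrite exchange_big /= (bigID (mem (nbhd E A))) /=.
rewrite [X in (_ + X)%N]big1 ?addn0; last first.
  move=> v /andP[_ vN]; rewrite big1 // => u uA; apply/eqP.
  by rewrite -leqn0 leqNgt; apply: contra vN => uv; apply/in_nbhd; exists u.
rewrite [leqLHS](eq_bigl (mem (boundary E A))); last by move=> v; rewrite !inE.
rewrite mulnC -sum_nat_const; apply: leq_sum => v _.
rewrite -(Ed v); under eq_bigr do rewrite mult_sym.
by rewrite [leqRHS](bigID (mem A)) /= leq_addr.
Qed.

End Boundary.

Section CheegerConstant.
Variables (R : realType) (V : finType) (E : multigraph V).

Lemma expander_boundary (eps : R) (A : {set V}) :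
  vertex_expander E eps -> A != set0 -> (#|A|.*2 <= #|V|)%N ->
  eps * #|A|%:R <= #|boundary E A|%:R.
Proof.
move=> Ee A0 An; have A_gt0 : 0 < #|A|%:R :> R by rewrite ltr0n card_gt0.
rewrite -ler_pdivlMr //; apply: le_trans Ee _; apply: ge_inf; last first.
  by exists A => //; split=> //; apply/eqP.
by exists 0 => _ [B _ <-]; rewrite divr_ge0.
Qed.

Lemma le_cheeger (c : R) : (2 <= #|V|)%N ->
  (forall A : {set V}, A != set0 -> (#|A|.*2 <= #|V|)%N ->
     c * #|A|%:R <= #|boundary E A|%:R) -> c <= cheeger E R.
Proof.
move=> V2 Hc; apply: lb_le_inf.
  have /card_gt0P[v _] := ltnW V2.
  exists (#|boundary E [set v]|%:R / #|[set v]|%:R), [set v] => //.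
  by split; [apply/eqP/set0Pn; exists v; rewrite inE | rewrite cards1].
move=> _ [B [/eqP B0 Bn] <-]; rewrite ler_pdivlMr ?Hc //.
by rewrite ltr0n card_gt0.
Qed.

End CheegerConstant.

(** * The adjacency operator on functions *)

Section Operator.
Variables (R : realFieldType) (V : finType).
Implicit Types f g : V -> R.

Definition dot f g := \sum_u f u * g u.

Definition adjop (E : multigraph V) f : V -> R :=
  fun u => \sum_v (E u v)%:R * f v.

Variable E : multigraph V.

Lemma dotC f g : dot f g = dot g f.
Proof. by apply: eq_bigr => u _; rewrite mulrC. Qed.

Lemma dotDl f g h : dot (fun u => f u + g u) h = dot f h + dot g h.
Proof. by rewrite -big_split; apply: eq_bigr => u _; rewrite mulrDl. Qed.

Lemma dotZl a f g : dot (fun u => a * f u) g = a * dot f g.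
Proof. by rewrite mulr_sumr; apply: eq_bigr => u _; rewrite mulrA. Qed.

Lemma dotDr f g h : dot h (fun u => f u + g u) = dot h f + dot h g.
Proof. by rewrite dotC dotDl !(dotC h). Qed.

Lemma dotZr a f g : dot g (fun u => a * f u) = a * dot g f.
Proof. by rewrite dotC dotZl dotC. Qed.

Lemma dot_gt0 f : (exists u, f u != 0) -> 0 < dot f f.
Proof.
move=> [u fu]; rewrite /dot (bigD1 u) //= ltr_pwDl //.
  by rewrite -expr2 lt_def sqr_ge0 sqrf_eq0 fu.
by apply: sumr_ge0 => v _; rewrite -expr2 sqr_ge0.
Qed.

Lemma adjop_sym f g : dot (adjop E f) g = dot f (adjop E g).
Proof.
rewrite /dot /adjop; under eq_bigr do rewrite mulr_suml.
rewrite exchange_big; apply: eq_bigr => v _ /=.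
rewrite mulr_sumr; apply: eq_bigr => u _; rewrite (mult_sym E v u); ring.
Qed.

Lemma adjopD f g : adjop E (fun u => f u + g u) = fun u => adjop E f u + adjop E g u.
Proof.
apply/funext => u; rewrite -big_split; apply: eq_bigr => v _; by rewrite mulrDr.
Qed.

Lemma adjopZ a f : adjop E (fun u => a * f u) = fun u => a * adjop E f u.
Proof.
apply/funext => u; rewrite mulr_sumr; apply: eq_bigr => v _; by rewrite mulrCA.
Qed.

Lemma adjop_cst d a : mgregular E d -> adjop E (fun=> a) = fun=> d%:R * a.
Proof.
by move=> Ed; apply/funext => u; rewrite /adjop -mulr_suml -natr_sum Ed.
Qed.

Lemma sum_adjop d f : mgregular E d -> \sum_u adjop E f u = d%:R * \sum_u f u.
Proof.
move=> Ed; rewrite exchange_big mulr_sumr; apply: eq_bigr => v _ /=.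
by rewrite -mulr_suml -natr_sum; under eq_bigr do rewrite mult_sym; rewrite Ed.
Qed.

Lemma adjop_mgpow k f : adjop (mgpow E k) f = iter k (adjop E) f.
Proof.
elim: k f => [|k IH] f; apply/funext => u.
  rewrite /adjop (bigD1 u) // mgpow0 eqxx mul1r big1; first exact: addr0.
  by move=> v; rewrite mgpow0 eq_sym => /negbTE->; rewrite mul0r.
rewrite iterS -IH /adjop; under [RHS]eq_bigr do rewrite mulr_sumr.
rewrite exchange_big; apply: eq_bigr => v _.
rewrite mgpowS natr_sum mulr_suml; apply: eq_bigr => x _.
by rewrite natrM mulrA.
Qed.

Lemma energyE d f : mgregular E d ->
  \sum_u \sum_v (E u v)%:R * (f u - f v) ^+ 2
  = 2 * (d%:R * dot f f - dot (adjop E f) f).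
Proof.
move=> Ed.
have -> : \sum_u \sum_v (E u v)%:R * (f u - f v) ^+ 2 =
   \sum_u (d%:R * (f u * f u) + adjop E (fun v => f v * f v) u
            - 2 * (adjop E f u * f u)).
  apply: eq_bigr => u _; rewrite -(Ed u) natr_sum mulr_suml.
  rewrite /adjop [adjop E f u * _]mulr_suml mulr_sumr -big_split -sumrB /=.
  by apply: eq_bigr => v _; ring.
rewrite sumrB big_split /= -!mulr_sumr (sum_adjop _ Ed) /dot; ring.
Qed.

(** The bound cannot simply be iterated, since L may have eigenvalues far
    below -s. Instead, for odd k = 2 m + 1, the polynomial s ^ k - x ^ k is
    s - x times a sum of squares; on the moments b j = <L ^ j f, f> this becomes
    the induction C below, whose step is the hypothesis for L ^ m (L + s) f. *)
Lemma odd_power_rayleigh d (s : R) : mgregular E d ->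
  (forall f, \sum_u f u = 0 -> dot (adjop E f) f <= s * dot f f) ->
  forall f k, \sum_u f u = 0 -> odd k ->
  dot (adjop (mgpow E k) f) f <= s ^+ k * dot f f.
Proof.
move=> Ed Es f k f0 k_odd; rewrite adjop_mgpow.
have sum0 j : \sum_u iter j (adjop E) f u = 0.
  by elim: j => //= j IH; rewrite (sum_adjop _ Ed) IH mulr0.
pose b j := dot (iter j (adjop E) f) f.
have bD i j : dot (iter i (adjop E) f) (iter j (adjop E) f) = b (i + j)%N.
  elim: j i => [|j IH] i; first by rewrite addn0.
  by rewrite [iter j.+1 _ _]iterS -adjop_sym -iterS IH addSnnS.
have Q1 m : b (m.*2.+1) <= s * b m.*2.
  by have := Es _ (sum0 m); rewrite -iterS !bD addSn addnn.
have Q2 m : b (m.+1.*2.+1) + s * b m.+1.*2 <= s ^+ 2 * (b m.*2.+1 + s * b m.*2).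
  pose g u := iter m.+1 (adjop E) f u + s * iter m (adjop E) f u.
  have g0 : \sum_u g u = 0.
    rewrite big_split -mulr_sumr (sum0 m.+1) (sum0 m) mulr0; exact: addr0.
  have := Es g g0; rewrite /g adjopD adjopZ -!iterS.
  rewrite !(dotDl, dotDr, dotZl, dotZr) !bD !(addSn, addnS) !addnn doubleS.
  move: (b _) (b _) (b _) (b _) => b0 b1 b2 b3; lra.
have C m : b m.*2.+1 + s * b m.*2 <= 2 * s ^+ m.*2.+1 * b 0%N.
  elim: m => [|m IH]; first by have := Q1 0%N; rewrite double0 expr1; lra.
  apply: (le_trans (Q2 m)); have := ler_wpM2l (sqr_ge0 s) IH.
  by move/le_trans; apply; rewrite doubleS !exprS; lra.
have := C k./2; have := Q1 k./2.
have <- : k = k./2.*2.+1 by rewrite -[LHS]odd_double_half k_odd.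
rewrite -/(b k) -[dot f f]/(b 0%N); lra.
Qed.

End Operator.

(** * Spectral consequences of vertex expansion *)

Section Spectral.
Variables (R : realType) (V : finType).
Implicit Types (M E : multigraph V) (A B : {set V}) (f : V -> R).

(** Each boundary vertex receives at least one edge, so the edge cuts dominate
    the vertex boundaries and the weighted Cheeger inequality applies. *)
Lemma rayleigh_gap M d (h : R) f : mgregular M d -> (0 < d)%N -> 0 < h ->
  (forall A, A != set0 -> (#|A|.*2 <= #|V|)%N ->
     h * #|A|%:R <= #|boundary M A|%:R) ->
  \sum_u f u = 0 ->
  dot (adjop M f) f <= (d%:R - h ^+ 2 / (2 * d%:R)) * dot f f.
Proof.
move=> Md d0 h0 Mh f0; have dR : 0 < d%:R :> R by rewrite ltr0n.
have := @cheeger_rayleigh R V (fun u v => (M u v)%:R) d%:R h f.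
rewrite (energyE f Md) (_ : \sum_v f v ^+ 2 = dot f f); last first.
  by apply: eq_bigr => v _; rewrite expr2.
have w0 (u v : V) : 0 <= (M u v)%:R :> R by [].
have wC (u v : V) : (M u v)%:R = (M v u)%:R :> R by rewrite mult_sym.
have wd u : \sum_v (M u v)%:R = d%:R :> R by rewrite -natr_sum Md.
move=> /(_ w0 wC wd h0 dR) H.
have {}H : h ^+ 2 / d%:R * dot f f <= 2 * (d%:R * dot f f - dot (adjop M f) f).
  apply: H => // A A0 An; apply: le_trans (Mh A A0 An) _.
  apply: (@le_trans _ _ (\sum_(u in A) \sum_(v in ~: A) M u v)%N%:R).
    by rewrite ler_nat boundary_le_cut.
  by rewrite natr_sum; under eq_bigr do rewrite natr_sum.
rewrite (_ : h ^+ 2 / (2 * d%:R) = h ^+ 2 / d%:R / 2); first by lra.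
by field; rewrite gt_eqF.
Qed.

Lemma eigenvalue_function E d (lambda : R) : (0 < d)%N ->
  eigenvalue (normalised_adjmx E R d) lambda ->
  exists2 f : V -> R, exists u, f u != 0 &
    adjop E f = fun u => d%:R * lambda * f u.
Proof.
move=> d0 /eigenvalueP[v vE v0].
exists (fun u => v 0 (enum_rank u)).
  have [i vi] : exists i, v 0 i != 0.
    apply/existsP; apply: contraR v0; rewrite negb_exists => /forallP v0.
    apply/eqP/rowP => i; rewrite mxE; apply/eqP.
    by have := v0 i; rewrite negbK.
  by exists (enum_val i); rewrite enum_valK.
apply/funext => u; have /rowP/(_ (enum_rank u)) := vE.
rewrite !mxE -mulrA => <-.
rewrite (reindex enum_rank) /=; last exact/onW_bij/enum_rank_bij.
rewrite mulr_sumr; apply: eq_bigr => x _; rewrite !mxE !enum_rankK mult_sym.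
by field; rewrite pnatr_eq0 -lt0n.
Qed.

(** The easy half of the Cheeger inequality: the Rayleigh quotient of the
    indicator of A minus its mean compares the cut of A with #|A|, and a
    boundary vertex receives at most d edges. *)
Lemma cheeger_of_rayleigh M d (s : R) : mgregular M d -> (2 <= #|V|)%N -> (0 < d)%N ->
  s <= 1 ->
  (forall f, \sum_u f u = 0 -> dot (adjop M f) f <= d%:R * s * dot f f) ->
  2^-1 * (1 - s) <= cheeger M R.
Proof.
move=> Md V2 d0 s1 Ms; apply: le_cheeger => // A A0 An.
have dR : 0 < d%:R :> R by rewrite ltr0n.
set n := #|V|%:R : R; set a := #|A|%:R : R.
have n0 : 0 < n by rewrite ltr0n ltnW.
have an : 2 * a <= n by rewrite -natrM ler_nat mul2n.
have a0 : 0 < a by rewrite ltr0n card_gt0.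
pose i u : R := (u \in A)%:R.
have iS : \sum_u i u = a.
  by rewrite -natr_sum /a -sum1_card [in RHS]big_mkcond.
have ii : dot i i = a.
  rewrite -iS; apply: eq_bigr => u _; rewrite /i.
  by case: (u \in A); rewrite ?mulr0 ?mulr1.
pose one (u : V) : R := 1.
have oo : dot one one = n by rewrite /dot /one sumr_const mulr1.
have io : dot i one = a by rewrite -iS; apply: eq_bigr => u _; rewrite mulr1.
pose f u := i u + (- (a / n)) * one u.
have f0 : \sum_u f u = 0.
  have oS : \sum_u one u = n by rewrite sumr_const.
  by rewrite big_split -mulr_sumr iS oS /= mulNr divfK ?subrr ?gt_eqF.
have Mone : adjop M one = fun u => d%:R * one u by exact: adjop_cst.
pose c := \sum_(u in A) \sum_(v in ~: A) (M u v)%:R : R.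
have Mii : dot (adjop M i) i = d%:R * a - c.
  have -> : d%:R * a = \sum_(u in A) \sum_v (M u v)%:R.
    under eq_bigr do rewrite -natr_sum Md.
    by rewrite sumr_const mulr_natr.
  rewrite -sumrB [RHS]big_mkcond /=; apply: eq_bigr => u _; rewrite /i.
  case: (u \in A); rewrite ?mulr0 // mulr1 /adjop -/i.
  rewrite [\sum_(v in ~: A) _]big_mkcond -sumrB; apply: eq_bigr => v _.
  by rewrite /i inE; case: (v \in A); rewrite /= ?mulr1 ?subr0 ?mulr0 ?subrr.
have Mf : adjop M f = fun u => adjop M i u + (- (a / n) * d%:R) * one u.
  by rewrite /f adjopD (adjopZ M _ one); apply/funext => u; rewrite Mone mulrA.
have Mio : dot (adjop M i) one = d%:R * a by rewrite adjop_sym Mone dotZr io.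
have := Ms f f0.
rewrite Mf /f !(dotDl, dotDr, dotZl, dotZr) (dotC one i) Mii Mio oo io ii => H.
have {}H : d%:R * (1 - s) * (a * (1 - a / n)) <= c.
  rewrite -subr_ge0; move: H; rewrite -subr_ge0.
  by congr (0 <= _); field; rewrite gt_eqF.
have cb : c <= d%:R * #|boundary M A|%:R.
  rewrite -natrM.
  apply: le_trans (_ : (\sum_(u in A) \sum_(v in ~: A) M u v)%N%:R <= _).
    by rewrite natr_sum; under [leRHS]eq_bigr do rewrite natr_sum.
  by rewrite ler_nat cut_le_boundary.
have {}H := le_trans H cb; rewrite -mulrA ler_pM2l // in H.
apply: le_trans H; rewrite (mulrC 2^-1) -mulrA ler_wpM2l ?subr_ge0 //.
rewrite mulrC ler_wpM2l ?(ltW a0) // lerBrDr -lerBrDl.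
rewrite ler_pdivrMr //; lra.
Qed.

(** An eigenvalue close to -d gives one close to d ^ 2 for the square of M,
    which therefore cannot be a good expander. *)
Lemma almost_bipartite_set M d (b mu : R) f :
  mgregular M d -> (0 < d)%N -> 0 < b ->
  adjop M f = (fun u => mu * f u) -> \sum_u f u = 0 -> (exists u, f u != 0) ->
  d%:R ^+ 2 - mu ^+ 2 < b ^+ 2 / (2 * d%:R ^+ 2) ->
  exists A, [/\ A != set0, (#|A|.*2 <= #|V|)%N &
    #|nbhd M (nbhd M A) :\: A|%:R <= b * #|A|%:R].
Proof.
move=> Md d0 b0 Mf f0 fn0 H; apply: contrapT => nA.
have d2 : (0 < d ^ 2)%N by rewrite expn_gt0 d0.
have Mb A : A != set0 -> (#|A|.*2 <= #|V|)%N ->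
    b * #|A|%:R <= #|boundary (mgpow M 2) A|%:R.
  move=> A0 An; rewrite leNgt; apply/negP => lt; apply: nA; exists A; split=> //.
  by rewrite ltW //; move: lt; rewrite /boundary nbhd_mgpow.
have := rayleigh_gap (mgpow_regular 2 Md) d2 b0 Mb f0.
rewrite adjop_mgpow /= Mf adjopZ Mf !dotZl mulrA -expr2 => le.
have := dot_gt0 fn0 => ff; rewrite ler_pM2r // natrX in le; lra.
Qed.

(** Multiplying by the sign character chi of the bipartition negates the
    operator, so the spectrum is symmetric. The signed function has sum zero
    because f is orthogonal to chi, an eigenfunction for -d. *)
Lemma bipartite_spectrum M d (eps mu : R) f (O : {set V}) :
  mgregular M d -> (0 < d)%N -> 0 < eps -> vertex_expander M eps ->
  (forall u v, mgadj M u v -> (u \in O) != (v \in O)) ->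
  adjop M f = (fun u => mu * f u) -> (exists u, f u != 0) -> mu != - d%:R ->
  - mu <= d%:R - eps ^+ 2 / (2 * d%:R).
Proof.
move=> Md d0 eps0 Meps bip Mf fn0 mud.
pose chi u : R := (-1) ^+ (u \in O).
have chi2 u : chi u * chi u = 1 by rewrite -expr2 sqrr_sign.
have anti g : adjop M (fun u => chi u * g u) = fun u => - chi u * adjop M g u.
  apply/funext => u; rewrite /adjop mulr_sumr; apply: eq_bigr => v _.
  have [/eqP->|] := boolP (M u v == 0%N); first by rewrite !mul0r mulr0.
  rewrite -lt0n => /bip; rewrite /chi.
  by case: (u \in O); case: (v \in O) => //= _; rewrite expr0 expr1; ring.
have chi_f : dot chi f = 0.
  have Mchi : adjop M chi = fun u => - d%:R * chi u.
    have := anti (fun=> 1); rewrite (_ : (fun u => chi u * 1) = chi); last first.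
      by apply/funext => u; rewrite mulr1.
    by move=> ->; apply/funext => u; rewrite (adjop_cst _ Md); ring.
  have := adjop_sym M chi f; rewrite Mchi Mf dotZl dotZr => /eqP.
  rewrite -subr_eq0 -mulrBl mulf_eq0 => /orP[|/eqP//].
  by rewrite subr_eq0 eq_sym (negbTE mud).
pose g u := chi u * f u.
have := @rayleigh_gap M d eps g Md d0 eps0 (fun A => expander_boundary Meps) chi_f.
have -> : adjop M g = fun u => - mu * g u.
  by rewrite anti Mf; apply/funext => u; rewrite /g; ring.
rewrite dotZl ler_pM2r // (_ : dot g g = dot f f) ?dot_gt0 //.
by apply: eq_bigr => u _; rewrite /g mulrACA chi2 mul1r.
Qed.

End Spectral.

(** * Sets hardly enlarged by two steps *)

Section TwoStep.
Variables (R : realType) (V : finType) (M : multigraph V) (d : nat) (eps : R).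
Hypotheses (Md : mgregular M d) (d0 : (0 < d)%N).
Hypotheses (eps0 : 0 < eps) (Meps : vertex_expander M eps).
Hypothesis (nbhd_ge : forall A : {set V}, (#|A| <= #|nbhd M A|)%N).
Implicit Types A B C : {set V}.
Let N := nbhd M.

Lemma expander_le_degree : (2 <= #|V|)%N -> eps <= d%:R.
Proof.
move=> V2; have /card_gt0P[v _] := ltnW V2.
have v0 : [set v] != set0 by apply/set0Pn; exists v; rewrite inE.
have := expander_boundary Meps v0; rewrite cards1 mulr1 => /(_ V2) /le_trans; apply.
rewrite ler_nat (leq_trans (subset_leq_card (subsetDl _ _))) //.
by rewrite (leq_trans (card_nbhd_le _ Md)) // cards1 muln1.
Qed.

Lemma expander_bound A (delta : R) : (#|A|.*2 <= #|V|)%N ->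
  #|N A :\: A|%:R <= delta -> eps * #|A|%:R <= delta.
Proof.
move=> An le; have [->|A0] := eqVneq A set0.
  by rewrite cards0 mulr0 (le_trans _ le).
exact: le_trans (expander_boundary Meps A0 An) le.
Qed.

(** The set C :|: N C grows by at most delta in one step. Either it is at most
    half of the vertices, and expansion makes it small, or its complement is;
    the complement grows only into the neighbourhood of the delta new vertices. *)
Lemma two_step_expansion C (delta : R) : #|N (N C) :\: C|%:R <= delta ->
  eps * #|C|%:R <= delta \/
  eps * (#|V|%:R - 2 * #|C|%:R - delta) <= d%:R * delta.
Proof.
move=> le; set B := C :|: N C.
have BC : N B :\: B \subset N (N C) :\: C.
  apply/subsetP => v; rewrite /B /N nbhdU -/N in_setD !in_setU negb_or in_setD.
  by case/andP => /andP[-> /negbTE->].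
have {}BC := subset_leq_card BC.
have leB : #|N B :\: B|%:R <= delta by apply: le_trans le; rewrite ler_nat.
have CB : (#|C| <= #|B|)%N by rewrite subset_leq_card ?subsetUl.
have [Bn|Bn] := leqP #|B|.*2 #|V|; [left|right].
  apply: le_trans (expander_bound Bn leB).
  by rewrite ler_wpM2l ?(ltW eps0) // ler_nat.
have cB : (#|B| + #|~: B|)%N = #|V| := cardsC B.
have Wn : (#|~: B|.*2 <= #|V|)%N by move: Bn cB; rewrite -!addnn; lia.
have sub : N (~: B) :\: ~: B \subset N (N B :\: B).
  apply/subsetP => v; rewrite in_setD in_setC negbK => /andP[vB].
  case/in_nbhd => w wB wv; apply/in_nbhd; exists w; rewrite // in_setD.
  rewrite -in_setC wB; apply/in_nbhd; exists v => //.
  by rewrite mgadj_sym.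
have leW : #|N (~: B) :\: ~: B|%:R <= d%:R * delta.
  apply: (@le_trans _ _ (d%:R * #|N B :\: B|%:R)).
    by rewrite -natrM ler_nat (leq_trans (subset_leq_card sub)) // card_nbhd_le.
  by rewrite ler_wpM2l.
apply: le_trans (expander_bound Wn leW); rewrite ler_wpM2l ?(ltW eps0) //.
have NC : (#|N C|%:R : R) <= #|C|%:R + delta.
  apply: (@le_trans _ _ #|N (N C)|%:R); first by rewrite ler_nat nbhd_ge.
  apply: le_trans (lerD (lexx _) le); rewrite -natrD ler_nat.
  by rewrite -(cardsID C (N (N C))) leq_add2r subset_leq_card // subsetIr.
have : (#|V|%:R : R) <= #|C|%:R + #|N C|%:R + #|~: B|%:R.
  by rewrite -!natrD ler_nat -cB leq_add2r cardsU leq_subr.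
move: NC; lra.
Qed.

Variables (A : {set V}) (b : R).
(* In the application b = eps ^ 2 / (32 d ^ 2), which is small enough because
   eps <= d. *)
Hypotheses (A0 : A != set0) (A_half : (#|A|.*2 <= #|V|)%N).
Hypothesis (A_inv : #|N (N A) :\: A|%:R <= b * #|A|%:R).
Hypotheses (b_small : b <= 32^-1) (db_small : d%:R * b <= eps / 32).

Let a_gt0 : 0 < #|A|%:R :> R. Proof. by rewrite ltr0n card_gt0. Qed.

Let b_ge0 : 0 <= b.
Proof. by have := le_trans (ler0n _ _) A_inv; rewrite pmulr_lge0. Qed.

Let b_eps : b <= eps / 32.
Proof.
apply: le_trans db_small; rewrite ler_peMl //.
by rewrite ler1n.
Qed.

Let dba : d%:R * (b * #|A|%:R) <= eps / 32 * #|A|%:R.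
Proof. by rewrite mulrA ler_wpM2r. Qed.

Let ba : b * #|A|%:R <= eps / 32 * #|A|%:R.
Proof. by rewrite ler_wpM2r. Qed.

Let ba1 : b * #|A|%:R <= #|A|%:R / 32.
Proof. by rewrite [leRHS]mulrC ler_wpM2r. Qed.

Lemma almost_half : (16 * #|V| <= 33 * #|A|)%N.
Proof.
rewrite -(ler_nat R) !natrM.
have [H|] := two_step_expansion A_inv.
  have : eps * #|A|%:R <= eps * (#|A|%:R / 32).
    by rewrite (le_trans H) // (le_trans ba) // mulrAC mulrA.
  rewrite ler_pM2l //; have := a_gt0; lra.
move/le_trans/(_ dba); rewrite (mulrAC eps) -mulrA ler_pM2l // => H.
have := ba1; lra.
Qed.

Lemma almost_disjoint_nbhd : (32 * #|A :&: N A| <= #|A|)%N.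
Proof.
rewrite -(ler_nat R) !natrM.
have half : (#|A :&: N A|.*2 <= #|V|)%N.
  by rewrite (leq_trans _ A_half) // leq_double subset_leq_card // subsetIl.
have : #|N (A :&: N A) :\: (A :&: N A)|%:R <= b * #|A|%:R.
  apply: le_trans A_inv; rewrite ler_nat subset_leq_card //.
  apply/subsetP => v; rewrite !in_setD !in_setI => /andP[nv vN].
  have vNA : v \in N A by apply: subsetP vN; rewrite nbhdS // subsetIl.
  rewrite vNA andbT in nv; rewrite nv.
  by apply: subsetP vN; rewrite nbhdS // subsetIr.
move/(expander_bound half)/le_trans/(_ ba).
rewrite (mulrAC eps) -mulrA ler_pM2l //; lra.
Qed.

(** Two steps enlarge A :&: p @: A by no more than they enlarge A and p @: A
    together, so two_step_expansion applies to this intersection. *)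
Lemma translate_dichotomy (p : V -> V) : injective p ->
  N (N (p @: A)) \subset p @: N (N A) ->
  (16 * #|A :&: p @: A| <= #|A|)%N \/ (15 * #|A| <= 16 * #|A :&: p @: A|)%N.
Proof.
move=> pI pN; rewrite -!(ler_nat R) !natrM.
have : #|N (N (A :&: p @: A)) :\: (A :&: p @: A)|%:R <= 2 * (b * #|A|%:R).
  have sub : N (N (A :&: p @: A)) :\: (A :&: p @: A) \subset
     (N (N A) :\: A) :|: p @: (N (N A) :\: A).
    apply/subsetP => v; rewrite in_setD in_setI negb_and in_setU => /andP[nv vN].
    have vNA : v \in N (N A) by apply: subsetP vN; rewrite !nbhdS // subsetIl.
    have /imsetP[w wN vw] : v \in p @: N (N A).
      by apply/(subsetP pN); apply: subsetP vN; rewrite !nbhdS // subsetIr.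
    case/orP: nv => nv; first by rewrite in_setD nv vNA.
    apply/orP; right; apply/imsetP; exists w => //; rewrite in_setD wN andbT.
    by apply: contra nv => wA; rewrite vw imset_f.
  apply: (@le_trans _ _ (2 * #|N (N A) :\: A|%:R)); last by rewrite ler_wpM2l.
  rewrite -natrM ler_nat (leq_trans (subset_leq_card sub)) //.
  rewrite (leq_trans (leq_card_setU _ _)) // mul2n -addnn leq_add2l.
  exact: leq_imset_card.
case/two_step_expansion => H; [left|right].
  have : eps * (16 * #|A :&: p @: A|%:R) <= eps * #|A|%:R.
    by have := ba; lra.
  by rewrite ler_pM2l.
have : eps * (#|V|%:R - 2 * #|A :&: p @: A|%:R - 2 * (b * #|A|%:R))
    <= eps * (#|A|%:R / 16).
  apply: le_trans H _; have := dba; lra.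
rewrite ler_pM2l // => {}H.
have : (2 * #|A|%:R : R) <= #|V|%:R by rewrite -natrM ler_nat mul2n.
have := ba1; lra.
Qed.

End TwoStep.

(** * Almost invariant sets and subgroups of index two *)

Section Averaging.
Local Open Scope nat_scope.

(** Double counting of the pairs (p, x) with p in Q and both x and its image
    in A: the image of x is equidistributed on the orbit of x, so x contributes
    #|Q| times the proportion of its orbit that lies in A. *)
Lemma averaging_orbit (V : finType) (gT : finGroupType) (to : {action gT &-> V})
  (Q : {group gT}) (A : {set V}) (c e : nat) :
  A != set0 ->
  (forall p, p \in Q -> (c * #|A| <= e * #|A :&: [set to x p | x in A]|)%N) ->
  exists2 x, x \in A & (c * #|orbit to Q x| <= e * #|A :&: orbit to Q x|)%N.
Proof.
move=> A0 HA; apply: contrapT => nx.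
have lt x : x \in A -> (e * #|[set p in Q | to x p \in A]| < c * #|Q|)%N.
  move=> xA; rewrite -(card_orbit_stab to Q x).
  have -> : #|[set p in Q | to x p \in A]|%N
     = (#|A :&: orbit to Q x| * #|('C_Q[x | to])%g|)%N.
    rewrite -sum_nat_const -sum1_card.
    rewrite (partition_big (to x) (mem (A :&: orbit to Q x))) /=.
      apply: eq_bigr => y; rewrite inE => /andP[yA /orbitP[p pQ py]].
      rewrite -(card_rcoset _ p) -amove_act ?subsetT //.
      rewrite -(sum1_card (mem (amove to Q x (to x p)))).
      apply: eq_bigl => q; rewrite !in_set py.
      by apply/andP/andP => [[/andP[-> _] ->]//|[-> /eqP ->]]; rewrite eqxx yA.
    move=> p; rewrite !inE => /andP[pQ pxA]; rewrite pxA.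
    exact: (mem_orbit to).
  rewrite !mulnA ltn_pmul2r ?cardG_gt0 // ltnNge; apply/negP => le.
  by apply: nx; exists x.
have : (e * (\sum_(p in Q) #|A :&: [set to x p | x in A]|) < c * (#|A| * #|Q|))%N.
  have -> : (\sum_(p in Q) #|A :&: [set to x p | x in A]| =
             \sum_(x in A) #|[set p in Q | to x p \in A]|)%N.
    have -> : (\sum_(x in A) #|[set p in Q | to x p \in A]| =
        \sum_(p in Q) \sum_(x in A) (to x p \in A))%N.
      rewrite exchange_big /=; apply: eq_bigr => x _.
      rewrite -sum1_card big_mkcond [RHS]big_mkcond; apply: eq_bigr => p _.
      by rewrite inE; case: (p \in Q); case: (_ \in A).
    apply: eq_bigr => p _.
    have -> : A :&: [set to x p | x in A]
       = [set to x p | x in A :&: [set x | to x p \in A]].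
      apply/setP => y; rewrite inE; apply/andP/imsetP => [[yA /imsetP[x xA yx]]|].
        by exists x; rewrite // !inE xA -yx.
      by case=> x; rewrite !inE => /andP[xA pxA] ->; split=> //; apply/imsetP; exists x.
    rewrite card_imset; last exact: act_inj.
    rewrite -sum1_card big_mkcond [RHS]big_mkcond; apply: eq_bigr => x _.
    by rewrite !inE; case: (x \in A); case: (_ \in A).
  have [a aA] := set0Pn _ A0.
  rewrite big_distrr mulnCA -sum_nat_const (bigD1 a) //= [ltnRHS](bigD1 a) //=.
  by rewrite -addSn leq_add ?lt // leq_sum // => x /andP[xA _]; rewrite ltnW ?lt.
rewrite ltnNge => /negP; apply.
rewrite mulnCA mulnA mulnC -sum_nat_const big_distrr leq_sum // => p pQ.
by rewrite mulnC; exact: HA.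
Qed.

End Averaging.

Section LeftAction.
Local Open Scope nat_scope.
Variables (V : finType) (G : groupType) (act : G -> V -> V).
Hypothesis G_act : left_action act.
Implicit Types (H : {pred G}) (A S : {set V}).
Local Open Scope group_scope.

Lemma lact1 v : act 1 v = v. Proof. exact: G_act.1. Qed.
Lemma lactM g h v : act (g * h) v = act g (act h v). Proof. exact: G_act.2. Qed.
Lemma lactK g : cancel (act g) (act g^-1).
Proof. by move=> v; rewrite -lactM mulVg lact1. Qed.
Lemma lact_inj g : injective (act g). Proof. exact: can_inj (lactK g). Qed.

(** The acting group is not a finite group type, so its orbits are defined as
    finite sets through classical decidability. *)
Definition suborbit H x : {set V} := [set y | `[< exists2 h, h \in H & act h x = y >]].

Lemma suborbitP H x y : reflect (exists2 h, h \in H & act h x = y) (y \in suborbit H x).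
Proof. by rewrite inE; exact: asboolP. Qed.

(** The finite group that is averaged over is the image of H in the group of
    permutations of V. *)
Lemma averaging_suborbit H A (c e : nat) : group_closed H -> A != set0 ->
  (forall h, h \in H -> (c * #|A| <= e * #|A :&: act h @: A|)%N) ->
  exists2 x, x \in A & (c * #|suborbit H x| <= e * #|A :&: suborbit H x|)%N.
Proof.
move=> [H1 HD] A0 HA.
have HV h : h \in H -> h^-1 \in H by move=> hH; rewrite -[h^-1]mul1g; exact: HD.
have HM g h : g \in H -> h \in H -> g * h \in H.
  by move=> gH hH; rewrite -[h]invgK; apply: HD => //; exact: HV.
pose Q := [set p : {perm V} | `[< exists2 h, h \in H & p =1 act h >]].
have QP (p : {perm V}) : reflect (exists2 h, h \in H & p =1 act h) (p \in Q).
  by rewrite inE; exact: asboolP.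
have gQ : group_set Q.
  apply/group_setP; split; first by apply/QP; exists 1 => // v; rewrite perm1 lact1.
  move=> p q /QP[g gH pg] /QP[h hH qh]; apply/QP; exists (h * g); first exact: HM.
  by move=> v; rewrite permM lactM pg qh.
have orbE x : orbit 'P (Group gQ) x = suborbit H x.
  apply/setP => y; apply/orbitP/suborbitP => [[p /QP[h hH ph] <-]|[h hH <-]].
    by exists h => //; rewrite -ph.
  exists (perm (@lact_inj h)); first by apply/QP; exists h => // v; rewrite permE.
  by rewrite /= /aperm permE.
have [|x xA xo] := @averaging_orbit _ _ 'P%act (Group gQ) A c e A0.
  move=> p /QP[h hH ph]; rewrite (eq_imset _ ph); exact: HA.
by exists x; rewrite // -orbE.
Qed.

(** This says in one stroke that H is a subgroup of index at most two: both H
    and its complement are contained in a single left coset. *)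
Definition index_le2 H := forall g h, (g \in H) = (h \in H) -> g^-1 * h \in H.

Section Index2.
Variable H : {pred G}.
Hypothesis H2 : index_le2 H.

Lemma index_le2_1 : 1 \in H.
Proof. by have := H2 (erefl (1 \in H)); rewrite mulVg. Qed.

Lemma index_le2_V g : (g^-1 \in H) = (g \in H).
Proof.
have HV h : h \in H -> h^-1 \in H.
  by move=> hH; rewrite -[h^-1]mulg1; apply: H2; rewrite hH index_le2_1.
by apply/idP/idP => [/HV|/HV //]; rewrite invgK.
Qed.

Lemma index_le2_div g h : (g \in H) = (h \in H) -> g * h^-1 \in H.
Proof. by rewrite -[g in g * _]invgK => gh; apply: H2; rewrite !index_le2_V. Qed.

Lemma index_le2_Ml g h : g \in H -> (g * h \in H) = (h \in H).
Proof.
move=> gH; apply/idP/idP => hH.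
  by rewrite -[h](mulKg g); apply: H2; rewrite gH hH.
by rewrite -[h]invgK; apply: index_le2_div; rewrite index_le2_V gH hH.
Qed.

Lemma index_le2_Mr g h : h \in H -> (g * h \in H) = (g \in H).
Proof. by move=> hH; rewrite -index_le2_V invMg index_le2_Ml ?index_le2_V. Qed.

Lemma index_le2_closed : group_closed H.
Proof.
split; first exact: index_le2_1.
by move=> g h gH hH; apply: index_le2_div; rewrite gH hH.
Qed.

Lemma index_le2_index_two g : g \notin H -> index_two_subgroup H.
Proof.
move=> gH; split; first exact: index_le2_closed.
have cosetE x : [set x * h | h in [set` H]]%classic =
    [set y | (y \in H) = (x \in H)]%classic.
  apply/seteqP; split=> y /=.
    by case=> h /= hH <-; apply/idP/idP; rewrite index_le2_Mr.
  by move=> xy; exists (x^-1 * y); rewrite ?mulVKg //=; apply: H2.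
have -> : left_cosets H = [set [set` H]; ~` [set` H]]%classic.
  apply/seteqP; split=> C /=.
    case=> x _ <-; rewrite cosetE; case: (boolP (x \in H)) => xH; [left|right].
      by apply/seteqP; split=> y /=; [move=> ->|move=> ->].
    apply/seteqP; split=> y /=; first by move=> ->.
    by move=> /negP /negbTE.
  case=> ->; [exists 1 | exists g] => //; rewrite cosetE ?index_le2_1 ?(negbTE gH).
    by apply/seteqP; split=> y /=; [move=> ->|move=> ->].
  apply/seteqP; split=> y /=; first by move=> ->.
  by move=> /negP /negbTE.
apply/card_set_bijP; exists (fun C => if `[< C 1 >] then 0%N else 1%N).
have in1 : `[< [set` H]%classic 1 >] by apply/asboolP; exact: index_le2_1.
have nin1 : `[< (~` [set` H])%classic 1 >] = false.
  by apply/asboolPn => /=; rewrite index_le2_1.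
split.
- by move=> C /= [] ->; rewrite ?in1 ?nin1.
- by move=> C D /set_mem[] -> /set_mem[] ->; rewrite ?in1 ?nin1.
- move=> [|[|//]] _ /=; [exists [set` H]%classic|exists (~` [set` H])%classic].
  + by left.
  + by rewrite in1.
  + by right.
  + by rewrite nin1.
Qed.

Lemma suborbit_act h x : h \in H -> suborbit H (act h x) = suborbit H x.
Proof.
move=> hH; apply/setP => y; apply/suborbitP/suborbitP => -[g gH <-].
  by exists (g * h); rewrite ?lactM ?index_le2_Ml.
by exists (g * h^-1); [rewrite index_le2_Mr ?index_le2_V | rewrite lactM lactK].
Qed.

Lemma suborbit_eq x y : y \in suborbit H x -> suborbit H y = suborbit H x.
Proof. by case/suborbitP => h hH <-; exact: suborbit_act. Qed.

Hypothesis G_trans : forall u v, exists g, act g u = v.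

(** With g0 outside H, the orbits of x and of act g0 x under H cover V and
    are equinumerous, since g0 carries one onto the other; if they met, H
    would be transitive. *)
Lemma card_intransitive_suborbit g0 x : g0 \notin H -> ~ acts_transitively act H ->
  #|suborbit H x|.*2 = #|V|.
Proof.
move=> g0H ntr; set y := act g0 x.
have cover v : (v \in suborbit H x) || (v \in suborbit H y).
  have [g <-] := G_trans x v; case: (boolP (g \in H)) => gH.
    by apply/orP; left; apply/suborbitP; exists g.
  apply/orP; right; apply/suborbitP; exists (g * g0^-1); last by rewrite lactM lactK.
  by apply: index_le2_div; rewrite (negbTE gH) (negbTE g0H).
have orby : suborbit H y = act g0 @: suborbit H x.
  apply/setP => v; apply/suborbitP/imsetP => [[h hH <-]|[w /suborbitP[h hH <-] ->]].
    exists (act (g0^-1 * h * g0) x); last by rewrite -lactM !mulgA mulgV mul1g lactM.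
    apply/suborbitP; exists (g0^-1 * h * g0) => //; rewrite -mulgA; apply: H2.
    by rewrite index_le2_Ml.
  exists (g0 * h * g0^-1); last by rewrite /y -lactM mulgVK lactM.
  by apply: index_le2_div; rewrite index_le2_Mr.
have disj : suborbit H x :&: suborbit H y = set0.
  apply/eqP; rewrite -subset0; apply/subsetP => z; rewrite inE => /andP[zx zy].
  case: ntr => u v; have full w : w \in suborbit H x.
    by have := cover w; rewrite -(suborbit_eq zy) (suborbit_eq zx) orbb.
  have : v \in suborbit H u by rewrite (suborbit_eq (full u)).
  by case/suborbitP => h hH <-; exists h.
have := cardsUI (suborbit H x) (suborbit H y); rewrite disj cards0 addn0 orby.
rewrite card_imset; last exact: lact_inj.
rewrite addnn => <-; rewrite -orby -cardsT; apply: eq_card => v.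
by rewrite in_setU in_setT; exact: cover.
Qed.

End Index2.

Hypothesis G_trans : forall u v, exists g, act g u = v.

(** The pair of memberships in H and H' cuts the group into four parts, each
    contained in a left coset of the intersection K of H and H', so four
    translates of the orbit of y under K cover V. *)
Lemma card_quarter_orbit H H' y S : index_le2 H -> index_le2 H' ->
  (forall g, g \in H -> g \in H' -> act g y \in S) -> (#|V| <= 4 * #|S|)%N.
Proof.
move=> H2 H2' yS.
have [g gP] := choice (G_trans y).
pose c v := (g v \in H, g v \in H').
rewrite -cardsT -sum1_card (partition_big c predT) //=.
rewrite (_ : 4 = #|{: bool * bool}|); last by rewrite card_prod card_bool.
rewrite -sum_nat_const; apply: leq_sum => b _.
rewrite sum1dep_card.
have [->|[w]] := set_0Vmem [set v | (v \in [set: V]) && (c v == b)].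
  by rewrite cards0.
rewrite inE => /andP[_ /eqP wb].
rewrite -(card_imset _ (@lact_inj (g w)^-1)).
apply/subset_leq_card/subsetP => z /imsetP[v]; rewrite inE => /andP[_].
rewrite -wb => /eqP[vH vH'] ->; rewrite -{1}(gP v) -lactM; apply: yS.
  exact: H2.
exact: H2'.
Qed.

(** The image of H x is the orbit of th x under psi H, which again has index at
    most two. If the two orbits share a point y, they both contain its orbit under
    the intersection of H and psi H. *)
Lemma card_twisted_image_suborbit H x (th : V -> V) (psi : G -> G) : index_le2 H ->
  group_automorphism psi \/ group_anti_automorphism psi ->
  (forall g, th (act g x) = act (psi g) (th x)) ->
  suborbit H x :&: th @: suborbit H x != set0 ->
  (#|V| <= 4 * #|suborbit H x :&: th @: suborbit H x|)%N.
Proof.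
move=> H2 psiP th_psi /set0Pn[y].
rewrite inE => /andP[yx /imsetP[z /suborbitP[h1 h1H <-]]].
rewrite th_psi => yE.
(* phi is the inverse of psi; psi H is handled as the preimage of H under phi. *)
have [phi [psiK phiK phiM]] : exists phi : G -> G, [/\ cancel psi phi, cancel phi psi &
    (forall a b, phi (a * b) = phi a * phi b) \/
    (forall a b, phi (a * b) = phi b * phi a)].
  case: psiP => -[[phi psiK phiK] psiM]; exists phi; split=> //; [left|right] => a b;
  by apply: (can_inj psiK); rewrite phiK psiM !phiK.
have phi1 : phi 1 = 1.
  have : phi 1 * phi 1 = phi 1 * 1 by rewrite mulg1; case: phiM => M; rewrite -M mulg1.
  exact: mulgI.
have phiV a : phi a^-1 = (phi a)^-1.
  apply: (@mulgI _ (phi a)); rewrite mulgV.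
  by case: phiM => M; rewrite -M ?mulgV ?mulVg.
have H2' : index_le2 [pred g | phi g \in H].
  move=> a b; rewrite !inE => ab; case: phiM => ->; rewrite phiV; first exact: H2.
  exact: index_le2_div.
apply: (card_quarter_orbit H2 H2' (y := y)) => k kH; rewrite inE => kH'.
rewrite inE; apply/andP; split.
  by rewrite -(suborbit_eq H2 yx); apply/suborbitP; exists k.
rewrite yE -lactM -[k * _]phiK -th_psi; apply: imset_f; apply/suborbitP.
by exists (phi (k * psi h1)) => //; case: phiM => ->; rewrite psiK
  ?(index_le2_Ml H2) ?(index_le2_Mr H2).
Qed.

End LeftAction.

(** * Bipartition of an almost bipartite graph *)

Lemma leq_card_setI2 (V : finType) (X Y B : {set V}) :
  (#|X :&: B| + #|Y :&: B| <= #|B| + #|X :&: Y|)%N.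
Proof.
rewrite -cardsUI leq_add // subset_leq_card // -?setIUl ?subsetIr //.
by apply: setISS; exact: subsetIl.
Qed.

Section Bipartition.
Local Open Scope nat_scope.
Variables (V : finType) (M : multigraph V) (G : groupType) (act : G -> V -> V).
Hypotheses (G_act : left_action act).
Hypothesis G_trans : forall u v, exists g, act g u = v.
Hypothesis G_index2 : forall H : {pred G},
  index_two_subgroup H -> ~ acts_transitively act H.
Variables (I : Type) (th : I -> V -> V).
Hypotheses (th_inj : forall i, injective (th i)).
Hypothesis th_adj : forall u v, mgadj M u v <-> exists i, th i u = v.
Hypothesis th_act : forall i x, exists2 psi : G -> G,
  group_automorphism psi \/ group_anti_automorphism psi &
  forall g, th i (act g x) = act (psi g) (th i x).
Variable A : {set V}.
Hypotheses (A0 : A != set0) (A_half : (#|A|.*2 <= #|V|)%N).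
Hypotheses (A_large : (16 * #|V| <= 33 * #|A|)%N).
Hypotheses (A_disj : (32 * #|A :&: nbhd M A| <= #|A|)%N).
Hypothesis A_act : forall g, (16 * #|A :&: act g @: A| <= #|A|)%N \/
  (15 * #|A| <= 16 * #|A :&: act g @: A|)%N.

Let H : {pred G} := [pred g | (15 * #|A| <= 16 * #|A :&: act g @: A|)%N].

Let A_gt0 : (0 < #|A|)%N. Proof. by rewrite card_gt0. Qed.

(** For g and h on the same side, the translates of A by g and by h both almost
    fill A, or both almost fill its complement, which is hardly larger than A. They
    thus share more than #|A| / 16 points, and the dichotomy puts g^-1 * h in H. *)
Lemma almost_stabiliser_index_le2 : index_le2 H.
Proof.
move=> g h; rewrite !inE => gh.
have cA k : #|act k @: A| = #|A| by rewrite card_imset //; exact: (lact_inj G_act).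
have E : #|A :&: act (g^-1 * h)%g @: A| = #|act g @: A :&: act h @: A|.
  rewrite -(card_imset _ (@lact_inj _ _ _ G_act g)) imsetI; last first.
    by move=> u v _ _; exact: (lact_inj G_act).
  rewrite -imset_comp; congr #|_ :&: _|; apply: eq_imset => v /=.
  by rewrite -(lactM G_act) mulKVg.
have := A_act (g^-1 * h)%g; rewrite E => -[small|//].
have := leq_card_setI2 (act g @: A) (act h @: A) A.
have := leq_card_setI2 (act g @: A) (act h @: A) (~: A).
have := cardsC A.
have := cardsID A (act g @: A); have := cardsID A (act h @: A).
rewrite !setDE !cA; rewrite ![A :&: _]setIC in gh.
have := A_act g; have := A_act h; rewrite ![A :&: _]setIC.
move: gh small A_gt0 A_large.
move: #|A| #|V| #|~: A| #|act g @: A :&: act h @: A|.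
move: #|act g @: A :&: A| #|act h @: A :&: A|.
by move: #|act g @: A :&: ~: A| #|act h @: A :&: ~: A|; lia.
Qed.

(** The set is an orbit O of the almost stabiliser of A. Since A contains
    all but 1/16 of O and meets its own neighbourhood in at most #|A| / 32 points,
    O meets its image under th i in fewer than #|V| / 4 points, hence in none. *)
Lemma almost_bipartite_bipartition : exists O : {set V},
  forall u v, mgadj M u v -> (u \in O) != (v \in O).
Proof.
have H2 := almost_stabiliser_index_le2.
have Hav K : index_le2 K -> (forall h, h \in K -> h \in H) ->
    exists2 x, x \in A & (15 * #|suborbit act K x| <= 16 * #|A :&: suborbit act K x|)%N.
  move=> K2 KH; apply: averaging_suborbit => //; first exact: index_le2_closed.
have [g0 g0H] : exists g0, g0 \notin H.
  apply: contrapT => /forallNP nH.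
  have allH h : h \in predT -> h \in H by move=> _; apply/negPn/negP; exact: nH.
  have T2 : index_le2 (predT : {pred G}) by [].
  have [x xA] := Hav _ T2 allH.
  have -> : suborbit act predT x = setT.
    apply/setP => v; rewrite in_setT; apply/suborbitP.
    by have [g gv] := G_trans x v; exists g.
  by rewrite setIT cardsT => le; move: A_gt0 A_half; lia.
have Hntr := G_index2 (index_le2_index_two H2 g0H).
have half x := card_intransitive_suborbit G_act H2 G_trans x g0H Hntr.
have [x xA xo] := Hav H H2 (fun h hH => hH).
set O := suborbit act H x in xo.
have On : #|O|.*2 = #|V| by exact: half.
have disj i : O :&: th i @: O = set0.
  apply/eqP; apply/negPn/negP => ne.
  have [psi psiP th_psi] := th_act i x.
  have := card_twisted_image_suborbit G_act G_trans H2 psiP th_psi ne; rewrite -/O.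
  have sub : O :&: th i @: O \subset
      (A :&: th i @: A) :|: (O :\: A :|: th i @: (O :\: A)).
    apply/subsetP => v; rewrite !in_setU !in_setI in_setD => /andP[vO /imsetP[w wO vw]].
    rewrite vO; have [vA|//] := boolP (v \in A).
    have [wA|wA] := boolP (w \in A); first by rewrite vw imset_f.
    by rewrite vw [_ \in th i @: (_ :\: _)]imset_f ?orbT // in_setD wA.
  have := leq_trans (subset_leq_card sub) (leq_card_setU _ _).
  have := (leq_card_setU (O :\: A) (th i @: (O :\: A))).1.
  have : (#|th i @: (O :\: A)| <= #|O :\: A|)%N by exact: leq_imset_card.
  have : (#|A :&: th i @: A| <= #|A :&: nbhd M A|)%N.
    apply/subset_leq_card/setIS/subsetP => v /imsetP[w wA ->].
    by apply/in_nbhd; exists w => //; apply/th_adj; exists i.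
  have := cardsID A O; rewrite (setIC O A).
  move: xo On A_disj A_half A_gt0.
  move: #|O :\: A :|: _| #|th i @: (O :\: A)| #|O :&: th i @: O|.
  move: #|A :&: th i @: A| #|A :&: nbhd M A| #|O :\: A| #|A :&: O| #|A| #|O| #|V|; lia.
have thO i : th i @: O = ~: O.
  apply/eqP; rewrite eqEcard card_imset // -(leq_add2l #|O|) cardsC addnn.
  rewrite On leqnn andbT.
  by rewrite -disjoints_subset -setI_eq0 setIC disj.
exists O => u v /th_adj[i <-].
have [uO|uO] := boolP (u \in O).
  have : th i u \in th i @: O by apply: imset_f.
  by rewrite thO in_setC => /negbTE->.
have [//|vO] := boolP (th i u \in O).
by move: vO; rewrite -in_setC -(thO i) mem_imset // (negbTE uO).
Qed.

End Bipartition.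

(** * Nontrivial eigenvalues of powers of expanders *)

Lemma ler_odd_exp (R : realDomainType) (k : nat) (x y : R) : odd k ->
  x <= y -> x ^+ k <= y ^+ k.
Proof.
move=> k_odd xy; have [x0|x0] := lerP 0 x.
  by rewrite lerXn2r ?nnegrE // (le_trans x0).
have [y0|y0] := lerP 0 y.
  by rewrite (@le_trans _ _ 0) ?exprn_ge0 // exprn_odd_le0 // ltW.
have expN t : t ^+ k = - (- t) ^+ k.
  by rewrite [in RHS]exprNn -signr_odd k_odd expr1 mulN1r opprK.
rewrite expN [leRHS]expN lerN2.
by rewrite lerXn2r ?nnegrE ?oppr_ge0 ?lerN2 // ltW.
Qed.

Lemma eqr_odd_expN1 (R : realDomainType) (k : nat) (x : R) : odd k ->
  x ^+ k = -1 -> x = -1.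
Proof.
move=> k_odd xk; have k0 : (0 < k)%N by case: k k_odd {xk}.
have : `|x| ^+ k == 1 by rewrite -normrX xk normrN1.
rewrite pexpr_eq1 // eqr_norml ler01 andbT => /orP[] /eqP // x1.
by move: xk; rewrite x1 expr1n.
Qed.

Lemma cheeger_mgpow (R : realType) (V : finType) (E : multigraph V) d k (eps : R) :
  mgregular E d -> (0 < d)%N -> (2 <= #|V|)%N -> odd k ->
  0 < eps -> vertex_expander E eps ->
  2^-1 * (1 - (1 - eps ^+ 2 / (2 * d%:R ^+ 2)) ^+ k) <= cheeger (mgpow E k) R.
Proof.
move=> Ed d0 V2 k_odd eps0 Eeps; have dR : 0 < d%:R :> R by rewrite ltr0n.
set s := 1 - _ / _.
apply: (cheeger_of_rayleigh (mgpow_regular k Ed)) => //; first by rewrite expn_gt0 d0.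
  rewrite -[leRHS](expr1n _ k); apply: ler_odd_exp => //.
  by rewrite /s gerBl divr_ge0 ?sqr_ge0 // mulr_ge0 // sqr_ge0.
move=> f f0; rewrite natrX -exprMn; apply: (odd_power_rayleigh Ed) => // g g0.
have -> : d%:R * s = d%:R - eps ^+ 2 / (2 * d%:R) by rewrite /s; field; rewrite gt_eqF.
by apply: rayleigh_gap => // A A0 An; apply: expander_boundary.
Qed.

Section Theta.
Variables (V : finType) (d : nat) (theta : 'I_d -> {perm V}).

Lemma theta_comp_inj i : injective (theta_comp theta i).
Proof.
elim: i => [|j i IH] u v //= /perm_inj; exact: IH.
Qed.

Lemma mgadj_theta (E : multigraph V) :
  (forall v, nbhd E [set v] = \bigcup_(i < d) [set theta i v]) ->
  forall k u v, mgadj (mgpow E k) u v <->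
    exists i : k.-tuple 'I_d, theta_comp theta i u = v.
Proof.
move=> Eth k u v.
have -> : mgadj (mgpow E k) u v = (v \in iter k (nbhd E) [set u]).
  rewrite -nbhd_mgpow; apply/idP/in_nbhd => [uv|[w]]; first by exists u; rewrite ?inE.
  by rewrite inE => /eqP->.
have adj1 w x : mgadj E w x <-> exists j, theta j w = x.
  have -> : mgadj E w x = (x \in nbhd E [set w]).
    apply/idP/in_nbhd => [wx|[y]]; first by exists w; rewrite ?inE.
    by rewrite inE => /eqP->.
  rewrite Eth; split=> [/bigcupP[j _]|[j <-]]; first by rewrite inE => /eqP->; exists j.
  by apply/bigcupP; exists j; rewrite ?inE.
elim: k v => [|k IH] v /=.
  rewrite inE; split=> [/eqP->|[i <-]]; first by exists [tuple].
  by rewrite (tuple0 i).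
split=> [/in_nbhd[w /IH[i iw] /adj1[j jw]]|[i iv]].
  by exists [tuple of j :: i]; rewrite /= iw.
apply/in_nbhd; exists (theta_comp theta [tuple of behead i] u).
  by apply/IH; exists [tuple of behead i].
by apply/adj1; exists (thead i); rewrite -iv [in RHS](tuple_eta i).
Qed.

End Theta.

(** Inversion is itself an anti-automorphism, so twisting by psi g^-1 is again
    twisting by an automorphism or an anti-automorphism. *)
Lemma inverse_twist (G : groupType) (psi : G -> G) :
  group_automorphism psi \/ group_anti_automorphism psi ->
  group_automorphism (fun g => psi g^-1%g)
  \/ group_anti_automorphism (fun g => psi g^-1%g).
Proof.
have bijV : bijective psi -> bijective (fun g => psi g^-1%g).
  by move=> b; apply: (bij_comp b); exists (fun g : G => g^-1)%g => g; rewrite invgK.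
case=> -[b M]; [right|left]; split; try exact: bijV; move=> x y /=;
  by rewrite invMg M.
Qed.

Theorem theorem3p3 (R : realType) (d : nat) (V : finType) (E : multigraph V)
  (d_ge1 : (1 <= d)%N) (E_regular : mgregular E d) (V_ge4 : (4 <= #|V|)%N)
  (theta : 'I_d -> {perm V})
  (theta_adj : forall v i, mgadj E v (theta i v))
  (theta_nbhd : forall v,
     nbhd E [set v]%SET = (\bigcup_(i < d) [set theta i v])%SET)
  (G : groupType) (act : G -> V -> V) (G_act : left_action act)
  (k : nat) (k_ge1 : (1 <= k)%N) (k_odd : odd k) (eps_k : R)
  (H1 : forall H : {pred G},
     index_two_subgroup H -> ~ acts_transitively act H)
  (H2 : exists2 t : nat, (0 < t)%N &
     forall u v : V, ([set g : G | act g u = v]%classic #= `I_t)%card)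
  (H3 : 0 < eps_k /\ vertex_expander (mgpow E k) eps_k)
  (H4 : forall (i : k.-tuple 'I_d) (v : V), exists psi : G -> G,
     (group_automorphism psi \/ group_anti_automorphism psi) /\
     ((forall g : G,
         theta_comp theta i (act g v) = act (psi g) (theta_comp theta i v)) \/
      (forall g : G,
         theta_comp theta i (act g v)
         = act (psi (g^-1)%g) (theta_comp theta i v))))
  (H5 : forall (tau : G) (A : {set V}),
     iter k (nbhd E) (iter k (nbhd E) (act tau @: A)%SET)
     \subset (act tau @: iter k (nbhd E) (iter k (nbhd E) A))%SET) :
  (forall lambda : R, eigenvalue (normalised_adjmx E R d) lambda ->
     lambda != 1 -> lambda != -1 ->
     oddroot k (-1 + eps_k ^+ 4 / (2 ^+ 12 * d%:R ^+ (8 * k))) < lambda) /\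
  (forall eps : R, 0 < eps -> vertex_expander E eps ->
     2^-1 * (1 - (1 - eps ^+ 2 / (2 * d%:R ^+ 2)) ^+ k)
     <= cheeger (mgpow E k) R).
Proof.
have V2 : (2 <= #|V|)%N by apply: leq_trans V_ge4.
split; last by move=> eps eps0 Eeps; exact: cheeger_mgpow.
move=> lambda lam_eig lam1 lamN1; rewrite ltNge; apply/negP => lam_le.
have [eps0 Meps] := H3.
set M := mgpow E k in Meps.
have Md : mgregular M (d ^ k) by exact: mgpow_regular.
have D0 : (0 < d ^ k)%N by rewrite expn_gt0 d_ge1.
pose D : R := (d ^ k)%:R.
have D_gt0 : 0 < D by rewrite ltr0n.
have D_ge1 : 1 <= D by rewrite ler1n.
have Mth := mgadj_theta theta_nbhd k.
have M_act (i : k.-tuple 'I_d) x : exists2 psi : G -> G,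
    group_automorphism psi \/ group_anti_automorphism psi &
    forall g, theta_comp theta i (act g x) = act (psi g) (theta_comp theta i x).
  have [psi [psiP [tw|tw]]] := H4 i x; first by exists psi.
  by exists (fun g => psi g^-1%g) => //; exact: inverse_twist.
have M_ge (B : {set V}) : (#|B| <= #|nbhd M B|)%N.
  pose i := nseq_tuple k (Ordinal d_ge1).
  rewrite -(card_imset _ (@theta_comp_inj _ _ theta i)).
  apply/subset_leq_card/subsetP => v /imsetP[w wB ->].
  by apply/in_nbhd; exists w => //; apply/Mth; exists i.
have epsD : eps_k <= D by exact: (expander_le_degree Md Meps V2).
have G_trans u v : exists g, act g u = v.
  case: H2 => t t0 /(_ u v) card_uv; apply: contrapT => /forallNP no.
  have E0 : [set g : G | act g u = v]%classic = classical_sets.set0.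
    by apply/seteqP; split=> g //= /no.
  move: card_uv; rewrite E0 card_eq_sym card_eq0 => /eqP/seteqP[/(_ 0%N t0)].
  by [].
have [f fn0 Ef] := eigenvalue_function d_ge1 lam_eig.
pose m := lambda ^+ k.
have Mf : adjop M f = fun u => D * m * f u.
  rewrite adjop_mgpow /D natrX /m -exprMn.
  elim: (k) => [|j IH] /=; first by apply/funext => u; rewrite expr0 mul1r.
  by rewrite IH adjopZ Ef; apply/funext => u; rewrite exprSr -!mulrA.
have f0 : \sum_u f u = 0.
  have := sum_adjop f E_regular; rewrite Ef -mulr_sumr -mulrA => /eqP.
  rewrite (inj_eq (mulfI _)) ?pnatr_eq0 -?lt0n // -subr_eq0 -[X in _ - X]mul1r.
  by rewrite -mulrBl mulf_eq0 subr_eq0 (negbTE lam1) => /eqP.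
have mN1 : m != -1 by apply: contra lamN1 => /eqP/(eqr_odd_expN1 k_odd)->.
(* All thresholds are powers of r = eps_k / D, which is at most 1. *)
pose r := eps_k / D.
have r0 : 0 < r by rewrite divr_gt0.
have r1 : r <= 1 by rewrite ler_pdivrMr // mul1r.
have epsE : eps_k = r * D by rewrite /r divfK // gt_eqF.
pose z := r ^+ 4 / (2 ^+ 12 * D ^+ 4).
have m_le : m <= -1 + z.
  rewrite /m (le_trans (ler_odd_exp k_odd lam_le)) // oddrootK // lerD2l.
  rewrite mulnC exprM -(natrX _ d k) -/D epsE /z le_eqVlt; apply/orP; left; apply/eqP.
  by field; rewrite gt_eqF.
have z0 : 0 < z by rewrite divr_gt0 ?exprn_gt0 // mulr_gt0 ?exprn_gt0.
have z_small : z < r ^+ 2 / 2.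
  have D4 : 1 <= D ^+ 4 by rewrite exprn_ege1.
  rewrite /z ltr_pdivrMr ?mulr_gt0 ?exprn_gt0 //.
  have r2 : 0 < r ^+ 2 by rewrite exprn_gt0.
  have r21 : r ^+ 2 <= 1 by rewrite exprn_ile1 // ltW.
  rewrite (_ : r ^+ 4 = r ^+ 2 * r ^+ 2) -?exprD //; nra.
have [W bip] : exists W : {set V},
    forall u v, mgadj M u v -> (u \in W) != (v \in W).
  pose b := r ^+ 2 / 32.
  have b0 : 0 < b by rewrite divr_gt0 ?exprn_gt0.
  (* b is chosen so that b ^+ 2 / (2 * D ^+ 2) = 2 * z * D ^+ 2, while
     1 - m ^+ 2 = (1 - m) * (1 + m) is smaller than 2 * z. *)
  have gap : D ^+ 2 - (D * m) ^+ 2 < b ^+ 2 / (2 * D ^+ 2).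
    have -> : b ^+ 2 / (2 * D ^+ 2) = D ^+ 2 * (2 * z).
      by rewrite /b /z; field; rewrite gt_eqF.
    rewrite exprMn -[X in X - _]mulr1 -mulrBr ltr_pM2l ?exprn_gt0 //; nra.
  have [A [A0 An A_inv]] := almost_bipartite_set Md D0 b0 Mf f0 fn0 gap.
  have b1 : b <= 32^-1.
    by rewrite /b ler_pdivrMr // mulVf // exprn_ile1 // ltW.
  have Db : D * b <= eps_k / 32.
    rewrite epsE /b mulrA ler_wpM2r // mulrC ler_wpM2r ?(ltW D_gt0) //.
    by rewrite expr2 ger_pMr.
  apply: (almost_bipartite_bipartition G_act G_trans H1 _ Mth M_act A0 An).
  - exact: theta_comp_inj.
  - exact: (almost_half Md D0 eps0 Meps M_ge A0 A_inv b1 Db).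
  - exact: (almost_disjoint_nbhd D0 eps0 Meps A0 An A_inv Db).
  - move=> g; apply: (translate_dichotomy Md D0 eps0 Meps M_ge A0 An A_inv b1 Db).
      exact: lact_inj.
    by rewrite /M !nbhd_mgpow; exact: H5.
have muN : D * m != - D by rewrite -mulrN1 (inj_eq (mulfI (lt0r_neq0 D_gt0))).
have := bipartite_spectrum Md D0 eps0 Meps bip Mf fn0 muN.
rewrite (_ : D - _ = D * (1 - r ^+ 2 / 2)); last first.
  by rewrite epsE -/D; field; rewrite gt_eqF.
by rewrite -mulrN ler_pM2l //; lra.
Qed.
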